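(* Let $(m,f)$ be a pair of integers with $m\ge 2$, $0\le f\le\binom m2$ and $\sigma=\sigma(m,f)>0$. Suppose that for every $\epsilon>0$ there exists an integer $n$ such that at least $(\sigma-\epsilon)\binom{n}{2}$ integers of $S_n(m,f)$ belong to a union of at most $\epsilon\sqrt{n}$ intervals of consecutive integers. Then the limit $\lim_{n\to\infty}|S_n(m,f)|/\binom{n}{2}$ exists.
   Context: All graphs are finite and simple. For integers $m\ge 2$ and $0\le f\le \binom{m}{2}$, write $(n,e)\rightarrow(m,f)$ if every $n$-vertex graph with exactly $e$ edges contains an induced subgraph on $m$ vertices with exactly $f$ edges. Let $S_n(m,f)=\{e\in\{0,1,\dots,\binom n2\}: (n,e)\rightarrow(m,f)\}$ and $\sigma(m,f)=\limsup_{n\to\infty}|S_n(m,f)|/\binom{n}{2}$. *)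

(* Defs.v *)
From mathcomp Require Import all_boot all_order all_algebra.
From mathcomp Require Import all_classical all_reals all_analysis.
Set Implicit Arguments.
Unset Strict Implicit.
Unset Printing Implicit Defensive.
Import Order.TTheory GRing.Theory Num.Theory.
Import numFieldNormedType.Exports.
Local Open Scope ring_scope.

Record sgraph (T : finType) := SGraph {
  adj :> rel T;
  adj_sym : symmetric adj;
  adj_irr : irreflexive adj
}.

Definition edges (T : finType) (G : sgraph T) : {set {set T}} :=
  [set [set p.1; p.2] | p : T * T & G p.1 p.2].

Definition induced_edges (T : finType) (G : sgraph T) (U : {set T}) :
    {set {set T}} :=
  [set E in edges G | E \subset U].

(* (n, e) -> (m, f) *)
Definition arrows (n e m f : nat) : Prop :=
  forall G : sgraph 'I_n, #|edges G| = e ->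
    exists U : {set 'I_n}, #|U| = m /\ #|induced_edges G U| = f.

Definition Sset (n m f : nat) : {set 'I_('C(n, 2)).+1} :=
  [set e : 'I_('C(n, 2)).+1 | `[< arrows n e m f >]].

(* The value at n < 2 is the junk value 0. *)
Definition density (R : realType) (m f n : nat) : R :=
  #|Sset n m f|%:R / 'C(n, 2)%:R.

Definition sigma (R : realType) (m f : nat) : R := limn_sup (density R m f).

(* The trace on {0, ..., N - 1} of the interval of consecutive integers with
   end points J.1 and J.2; it is empty if J.2 < J.1. *)
Definition int_interval (N : nat) (J : nat * nat) : {set 'I_N} :=
  [set i : 'I_N | (J.1 <= i <= J.2)%N].

Definition int_intervals (N : nat) (s : seq (nat * nat)) : {set 'I_N} :=
  (\bigcup_(J <- s) int_interval N J)%SET.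

(* Main.v *)
(** Deleting a suitable vertex from a graph on j vertices moves its edge density
    by a controlled amount: the density after deletion, averaged over the
    vertices, is unchanged, and its variance is O(1/j^2).  Iterating, every graph
    on N vertices has an induced subgraph on n vertices whose density differs
    from the original one by O(1/sqrt n), uniformly in N.  Hence if e 'C(n,2) /
    'C(N,2) lies at distance at least C n^(3/2) from the ends of an interval
    contained in S_n(m,f), then e belongs to S_N(m,f).  With at most eps sqrt n
    intervals only O(eps n^2) elements of S_n(m,f) are lost near the ends, so
    the lower limit of the densities is at least sigma - O(eps). *)
Require Import Defs.
From mathcomp Require Import all_boot all_order all_algebra.
From mathcomp Require Import all_classical all_reals all_analysis.
From mathcomp Require Import ring lra zify.
Set Implicit Arguments.
Unset Strict Implicit.
Unset Printing Implicit Defensive.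
Import Order.TTheory GRing.Theory Num.Theory.
Import numFieldNormedType.Exports.
Local Open Scope ring_scope.

(** * Edge counts and densities of induced subgraphs *)

Lemma natr_bin2 (R : numFieldType) (n : nat) :
  'C(n.+1, 2)%:R = n.+1%:R * n%:R / 2 :> R.
Proof.
have h := mul_bin_diag n.+1 1; rewrite /= bin1 in h.
by rewrite -natrM h natrM mulrC mulrA mulVf ?mul1r // pnatr_eq0.
Qed.

Section InducedEdges.
Variables (T : finType) (G : sgraph T).
Implicit Types (U W : {set T}) (v : T) (E : {set T}).

Lemma edgesP E :
  reflect (exists x y, G x y /\ E = [set x; y]) (E \in edges G).
Proof.
apply: (iffP imsetP) => [[[x y] /= Gxy ->]|[x [y [Gxy ->]]]].
  by exists x, y; split=> //; move: Gxy; rewrite inE.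
by exists (x, y) => //; rewrite inE.
Qed.

Lemma card_edge E : E \in edges G -> #|E| = 2.
Proof.
case/edgesP=> x [y [Gxy ->]]; rewrite cards2; case: eqVneq => // exy.
by rewrite exy adj_irr in Gxy.
Qed.

Definition degree_in W v := #|[set E in induced_edges G W | v \in E]|.

Lemma card_induced_edgesD1 W v :
  #|induced_edges G W| =
  (#|induced_edges G (W :\ v)| + degree_in W v)%N.
Proof.
have -> : induced_edges G (W :\ v) =
    induced_edges G W :\: [set E in induced_edges G W | v \in E].
  apply/setP => E; rewrite !inE subsetD1.
  by case: (E \in edges G); case: (E \subset W); case: (v \in E).
rewrite /degree_in addnC -(cardsID [set E : {set T} | v \in E] (induced_edges G W)).
congr (_ + _)%N; apply: eq_card => E; rewrite !inE //.
by case: (E \in edges G); case: (E \subset W); case: (v \in E).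
Qed.

Lemma sum_degree_in W :
  (\sum_(v in W) degree_in W v = 2 * #|induced_edges G W|)%N.
Proof.
under eq_bigr => v _ do rewrite /degree_in -sum1_card big_mkcond.
rewrite exchange_big /= -[in RHS]sum1_card big_distrr [RHS]big_mkcond /=.
apply: eq_bigr => E _; case: ifPn => EW; last first.
  by rewrite big1 // => v _; rewrite inE (negbTE EW).
move: EW; rewrite inE => /andP[EG EW].
transitivity #|E|; last by rewrite (card_edge EG).
rewrite -sum1_card -big_mkcondr /=.
apply: eq_bigl => v; rewrite !inE EG EW /= andbC.
by case vE: (v \in E) => //=; rewrite (fintype.subsetP EW).
Qed.

(** The edges at [v] inside [W] all have the form [[set v; y]] with [y] in [W :\ v]. *)
Lemma degree_in_lt W v : v \in W -> (degree_in W v < #|W|)%N.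
Proof.
move=> vW; rewrite (cardsD1 v W) vW ltnS /degree_in.
apply: (leq_trans _ (leq_imset_card (fun y => [set v; y]) _)).
apply: subset_leq_card; apply/fintype.subsetP => E.
rewrite !inE => /andP[/andP[/edgesP[x [y [Gxy ->]]] sW]] vE.
have xW : x \in W by rewrite (fintype.subsetP sW) // !inE eqxx.
have yW : y \in W by rewrite (fintype.subsetP sW) // !inE eqxx orbT.
have nxy : x != y by apply: contraTneq Gxy => ->; rewrite adj_irr.
move: vE; rewrite !inE => /orP[/eqP ->|/eqP ->]; apply/imsetP.
  by exists y => //; rewrite !inE eq_sym nxy yW.
by exists x; [rewrite !inE nxy xW|rewrite finset.setUC].
Qed.

Lemma card_induced_edges_leq W : (#|induced_edges G W| <= 'C(#|W|, 2))%N.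
Proof.
rewrite -cards_draws; apply: subset_leq_card.
by apply/fintype.subsetP => E; rewrite !inE => /andP[EG ->]; rewrite card_edge.
Qed.

Definition edge_density (R : realFieldType) W : R :=
  #|induced_edges G W|%:R / 'C(#|W|, 2)%:R.

(* Averaging over v: the densities after deleting v have mean edge_density W,
   and each of them differs from it by at most 2 / (#|W| - 2). *)
Lemma delete_vertex_density (R : realFieldType) W (q : R) (n : nat) :
  #|W| = n.+3 ->
  exists2 v, v \in W & (edge_density R (W :\ v) - q) ^+ 2
    <= (edge_density R W - q) ^+ 2 + 8 * (n.+1%:R^-1 - n.+2%:R^-1).
Proof.
move=> cW; set D := edge_density R W; set K := 8 * _.
pose x v := edge_density R (W :\ v).
pose e : R := #|induced_edges G W|%:R.
pose d v : R := (degree_in W v)%:R.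
pose N : R := n%:R.
have N0 : 0 <= N by rewrite ler0n.
have sumd : \sum_(v in W) d v = 2 * e.
  by rewrite -natr_sum sum_degree_in natrM.
have DE : D = 2 * e / ((N + 3) * (N + 2)).
  rewrite /D /edge_density cW natr_bin2 -/e -(natr1 n.+2) -!(natr1 n.+1).
  rewrite -!(natr1 n) -/N; field.
  by rewrite !gt_eqF //; lra.
have xE v : v \in W -> x v = 2 * (e - d v) / ((N + 2) * (N + 1)).
  move=> vW; have := cardsD1 v W; rewrite vW cW add1n => -[cWv].
  rewrite /x /edge_density -cWv natr_bin2.
  have -> : #|induced_edges G (W :\ v)|%:R = e - d v :> R.
    by rewrite /e (card_induced_edgesD1 W v) natrD /d addrK.
  rewrite -(natr1 n.+1) -!(natr1 n) -/N; field.
  by rewrite !gt_eqF //; lra.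
have KE : K = 8 / ((N + 1) * (N + 2)).
  rewrite /K -(natr1 n.+1) -!(natr1 n) -/N; field.
  by rewrite !gt_eqF //; lra.
have cR : (#|W|)%:R = N + 3 :> R by rewrite cW -addn3 natrD.
have db v : v \in W -> 0 <= d v <= N + 2.
  move=> vW; rewrite ler0n /=; have := degree_in_lt vW.
  by rewrite cW ltnS -(ler_nat R) -addn2 natrD.
have eb : 0 <= 2 * e <= (N + 3) * (N + 2).
  rewrite mulr_ge0 ?ler0n //= -sumd -cR mulr_natl -sumr_const.
  by apply: ler_sum => v /db /andP[].
have sumx : \sum_(v in W) (x v - D) = 0.
  rewrite (eq_bigr (fun v => (2 * e / ((N + 2) * (N + 1)) - D)
     - 2 / ((N + 2) * (N + 1)) * d v)); last first.
    by move=> v vW; rewrite xE //; ring.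
  rewrite sumrB sumr_const -mulr_sumr sumd -[_ *+ #|_|]mulr_natl cR DE; field.
  by rewrite !gt_eqF //; lra.
have xb v : v \in W -> (x v - D) ^+ 2 <= K.
  move=> vW; have /andP[d0 d1] := db _ vW; case/andP: eb => e0 e1.
  (* Both terms of [z] lie between 0 and [(N + 3) * (N + 2)], hence so does the absolute value of
     [z]. *)
  pose z := 2 * e - (N + 3) * d v.
  have -> : x v - D = 2 * z / ((N + 3) * (N + 2) * (N + 1)).
    by rewrite xE // DE /z; field; rewrite !gt_eqF //; lra.
  have z2 : z ^+ 2 <= ((N + 3) * (N + 2)) ^+ 2.
    have : (N + 3) * d v <= (N + 3) * (N + 2).
      by rewrite ler_wpM2l //; lra.
    have : 0 <= (N + 3) * d v by rewrite mulr_ge0 //; lra.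
    move=> h1 h2; rewrite -subr_ge0 subr_sqr mulr_ge0 // /z; lra.
  set a := (N + 3) * (N + 2) in z2 *.
  have a0 : 0 < a by rewrite mulr_gt0 //; lra.
  have -> : (2 * z / (a * (N + 1))) ^+ 2 = z ^+ 2 / a ^+ 2 * (4 / (N + 1) ^+ 2).
    by field; rewrite !gt_eqF //; lra.
  apply: (@le_trans _ _ (1 * (4 / (N + 1) ^+ 2))).
    rewrite ler_wpM2r ?divr_ge0 ?sqr_ge0 ?ler0n //.
    by rewrite ler_pdivrMr ?exprn_gt0 // mul1r.
  rewrite KE mul1r ler_pdivrMr; last by rewrite exprn_gt0 //; lra.
  have -> : 8 / ((N + 1) * (N + 2)) * (N + 1) ^+ 2 = 8 * (N + 1) / (N + 2).
    by field; rewrite !gt_eqF //; lra.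
  by rewrite ler_pdivlMr; lra.
have [hV|noV] := pselect (exists2 v, v \in W &
  (x v - q) ^+ 2 <= (D - q) ^+ 2 + K); first exact: hV.
(* If every vertex failed, the cross term of the expanded square would be positive at each [v],
   since [(x v - D) ^+ 2] is at most [K]; but the cross terms sum to 0. *)
have pos v : v \in W -> 0 < 2 * (D - q) * (x v - D).
  move=> vW; have : (D - q) ^+ 2 + K < (x v - q) ^+ 2.
    by rewrite ltNge; apply/negP => h; apply: noV; exists v.
  have := xb v vW; have -> : (x v - q) ^+ 2 =
    (D - q) ^+ 2 + 2 * (D - q) * (x v - D) + (x v - D) ^+ 2 by ring.
  lra.
suff : 0 < \sum_(v in W) 2 * (D - q) * (x v - D).
  by rewrite -mulr_sumr sumx mulr0 ltxx.
have [v vW] : exists v, v \in W by apply/set0Pn; rewrite -card_gt0 cW.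
rewrite (bigD1 v) //= ltr_wpDr ?pos // sumr_ge0 // => u /andP[uW _].
exact/ltW/pos.
Qed.

(** Vertices are deleted one at a time with the target [q] kept fixed. The increments are
    differences of consecutive reciprocals, so they telescope to a bound independent of [k] up to a
    negative term. *)
Lemma subset_density (R : realFieldType) (n k : nat) W (q : R) :
  #|W| = (n.+2 + k)%N ->
  exists U : {set T}, #|U| = n.+2 /\ (edge_density R U - q) ^+ 2
    <= (edge_density R W - q) ^+ 2 + 8 * (n.+1%:R^-1 - (n + k).+1%:R^-1).
Proof.
elim: k W => [|k IHk] W cW.
  by exists W; rewrite cW !addn0 subrr mulr0 addr0.
have cW' : #|W| = (n + k).+3 by rewrite cW; lia.
have [v vW hv] := delete_vertex_density q cW'.
have /IHk[U [cU hU]] : #|W :\ v| = (n.+2 + k)%N.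
  by apply: succn_inj; rewrite -[LHS]add1n -[1%N]/(true : nat) -vW -cardsD1 cW'.
exists U; split=> //; rewrite addnS; move: hv hU.
move: (_ ^+ 2) (_ ^+ 2) (_ ^+ 2) (_ ^-1) (_ ^-1) (_ ^-1).
by move=> *; lra.
Qed.

Lemma subset_density_close (R : rcfType) (n : nat) W :
  (2 <= n <= #|W|)%N ->
  exists U : {set T}, #|U| = n /\
    `|edge_density R U - edge_density R W| <= 4 / Num.sqrt n%:R.
Proof.
case: n => [|[|n]] //= nW.
(* With the density of [W] itself as target, the initial squared error is 0. *)
have [U [cU hU]] := subset_density (edge_density R W) (esym (subnKC nW)).
exists U; split=> //.
rewrite subrr expr0n add0r in hU.
rewrite -(@ler_pXn2r R 2) ?nnegrE ?divr_ge0 ?sqrtr_ge0 ?ler0n //.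
rewrite real_normK ?num_real // exprMn exprVn sqr_sqrtr ?ler0n //.
apply: (le_trans hU).
have n0 : 0 <= n%:R :> R by rewrite ler0n.
have : 0 <= (n + (#|W| - n.+2)).+1%:R^-1 :> R by rewrite invr_ge0 ler0n.
have : 8 * n.+1%:R^-1 <= 4 ^+ 2 * n.+2%:R^-1 :> R.
  rewrite -(natr1 n.+1) -!(natr1 n) ler_pdivrMr; last lra.
  by rewrite mulrAC ler_pdivlMr; lra.
by move=> h1 h2; rewrite mulrBr (le_trans _ h1) // lerBlDr lerDl mulr_ge0.
Qed.

End InducedEdges.

(** * Relabelling induced subgraphs by ordinals *)

Section Pullback.
Variables (S T : finType) (h : S -> T) (h_inj : injective h) (G : sgraph T).

Definition pullback : sgraph S :=
  @SGraph S (relpre h G) (fun x y => adj_sym G (h x) (h y))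
    (fun x => adj_irr G (h x)).

Lemma induced_edges_pullback (V : {set S}) :
  #|induced_edges pullback V| = #|induced_edges G (h @: V)|.
Proof.
rewrite -(card_imset _ (imset_inj h_inj)); apply: eq_card => E.
apply/imsetP/idP => [[F]|].
  rewrite inE => /andP[/edgesP[x [y [Gxy ->]]] FV ->].
  rewrite inE imsetS // andbT; apply/edgesP; exists (h x), (h y); split=> //.
  by rewrite imsetU1 imset_set1.
rewrite inE => /andP[/edgesP[x [y [Gxy ->]]] sV].
have /imsetP[a aV xE] : x \in h @: V.
  by rewrite (fintype.subsetP sV) // !inE eqxx.
have /imsetP[b bV yE] : y \in h @: V.
  by rewrite (fintype.subsetP sV) // !inE eqxx orbT.
exists [set a; b]; last by rewrite imsetU1 imset_set1 xE yE.
rewrite inE; apply/andP; split.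
  by apply/edgesP; exists a, b; rewrite /= -xE -yE.
by apply/fintype.subsetP => z; rewrite !inE => /orP[] /eqP ->.
Qed.

End Pullback.

(** [arrows] speaks only of graphs on ordinals; enumerating [U] turns the subgraph induced on it
    into such a graph. *)
Lemma arrows_induced (T : finType) (G : sgraph T) (U : {set T}) (m f : nat) :
  arrows #|U| #|induced_edges G U| m f ->
  exists V : {set T}, #|V| = m /\ #|induced_edges G V| = f.
Proof.
pose h (i : 'I_#|U|) : T := enum_val i.
have h_inj : injective h := @enum_val_inj _ _.
have hT : h @: [set: 'I_#|U|] = U.
  apply/setP => x; apply/imsetP/idP => [[i _ ->]|xU]; first exact: enum_valP.
  by exists (enum_rank_in xU x); rewrite // /h enum_rankK_in.
move=> /(_ (pullback h G)) [|V [cV hV]].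
  transitivity #|induced_edges (pullback h G) [set: 'I_#|U|]|.
    by apply: eq_card => E; rewrite inE finset.subsetT andbT.
  by rewrite induced_edges_pullback // hT.
by exists (h @: V); rewrite card_imset // -induced_edges_pullback.
Qed.

(** * Points far from the ends of the intervals *)

Lemma mem_bigcup_seq (T : finType) (I : Type) (s : seq I) (F : I -> {set T})
    (x : T) :
  (x \in (\bigcup_(i <- s) F i)%SET) = has (fun i => x \in F i) s.
Proof.
by elim: s => [|i s IHs]; rewrite ?big_nil ?big_cons !inE //= IHs.
Qed.

Section DeepSet.
Variables (c t : nat).
Implicit Types (J : nat * nat) (s : seq (nat * nat)).

Definition deep_in (k : nat) J := ((J.1 + t <= k) && (k + t <= J.2))%N.

(* The top value c is left out: it has no full block of preimages in
   card_Sset_ge. *)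
Definition deep_set s : {set 'I_c} := [set k : 'I_c | has (deep_in k) s].

Lemma card_window (N a : nat) : (#|[set i : 'I_N | a <= i < a + t]| <= t)%N.
Proof.
rewrite cardE -(size_map val) -[leqRHS](size_iota a t).
apply: uniq_leq_size; first by rewrite (map_inj_uniq val_inj) enum_uniq.
by move=> _ /mapP[i + ->]; rewrite mem_enum inE mem_iota.
Qed.

Definition boundary J : {set 'I_c.+1} :=
  [set i in int_interval c.+1 J | ~~ deep_in i J || (i == ord_max)].

Lemma card_boundary J : (#|boundary J| <= 2 * t + 1)%N.
Proof.
set A := [set i : 'I_c.+1 | J.1 <= i < J.1 + t]%N.
(* If [t] exceeds [J.2.+1], the truncated difference is 0 and the window from 0 to [t - 1] still
   contains every [i <= J.2]. *)
set B := [set i : 'I_c.+1 | J.2.+1 - t <= i < J.2.+1 - t + t]%N.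
have sub : boundary J \subset A :|: B :|: [set ord_max].
  apply/fintype.subsetP => i; rewrite !inE /deep_in.
  case: (i == ord_max); rewrite ?orbT // !orbF; lia.
apply: (leq_trans (subset_leq_card sub)).
rewrite (leq_trans (leq_card_setU _ _)) // cards1 leq_add2r.
rewrite (leq_trans (leq_card_setU _ _)) // mul2n -addnn.
by rewrite leq_add ?card_window.
Qed.

Lemma card_int_intervals_leq s :
  (#|int_intervals c.+1 s| <= #|deep_set s| + (2 * t + 1) * size s)%N.
Proof.
pose h : 'I_c -> 'I_c.+1 := widen_ord (leqnSn c).
have cov : int_intervals c.+1 s \subset
    h @: deep_set s :|: (\bigcup_(J <- s) boundary J)%SET.
  rewrite /int_intervals; apply/fintype.subsetP => i.
  rewrite !inE !mem_bigcup_seq => /hasP[J Js iJ].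
  case bd: (i \in boundary J).
    by apply/orP; right; apply/hasP; exists J.
  move: bd; rewrite inE iJ /= => /norP[/negPn di imax].
  apply/orP; left; apply/imsetP.
  have ic : (i < c)%N.
    by rewrite ltn_neqAle -[(_ <= c)%N]ltnS ltn_ord andbT.
  exists (Ordinal ic); last exact: val_inj.
  by rewrite inE; apply/hasP; exists J.
apply: (leq_trans (subset_leq_card cov)).
rewrite (leq_trans (leq_card_setU _ _)) // leq_add ?leq_imset_card //.
elim: s {cov} => [|J s IHs]; first by rewrite big_nil cards0.
rewrite big_cons (leq_trans (leq_card_setU _ _)) //= mulnS.
by rewrite leq_add ?card_boundary.
Qed.

End DeepSet.

(** * Transfer from [n] vertices to [N] vertices *)

Lemma arrows_deep_in (R : realType) (m f n N e k t : nat)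
    (s : seq (nat * nat)) (J : nat * nat) :
  (2 <= n <= N)%N -> int_intervals ('C(n, 2)).+1 s \subset Sset n m f ->
  J \in s -> deep_in t k J ->
  `|e%:R * 'C(n, 2)%:R / 'C(N, 2)%:R - k%:R| <= 1 :> R ->
  4 / Num.sqrt n%:R * 'C(n, 2)%:R + 1 <= t%:R :> R ->
  arrows N e m f.
Proof.
move=> /andP[n2 nN] sS Js /andP[kl kr] ek tb G eG.
have nW : (2 <= n <= #|[set: 'I_N]|)%N by rewrite n2 cardsT card_ord.
have [U [cU dU]] := subset_density_close G R nW.
have c0 : 0 < 'C(n, 2)%:R :> R by rewrite ltr0n bin_gt0.
have eT : #|induced_edges G [set: 'I_N]| = e.
  by rewrite -eG; apply: eq_card => E; rewrite inE finset.subsetT andbT.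
rewrite /edge_density cU cardsT card_ord eT in dU.
(* The density deviation costs [4 / Num.sqrt n%:R * 'C(n, 2)%:R] edges, and the distance from the
   rescaled [e] to [k] costs at most 1. *)
have uk : `|#|induced_edges G U|%:R - k%:R| <= t%:R :> R.
  apply: le_trans tb; set u := #|_|%:R.
  have -> : u - k%:R = (u / 'C(n, 2)%:R - e%:R / 'C(N, 2)%:R) * 'C(n, 2)%:R +
     (e%:R * 'C(n, 2)%:R / 'C(N, 2)%:R - k%:R).
    by rewrite mulrBl divfK ?gt_eqF // mulrAC addrA subrK.
  apply: le_trans (ler_normD _ _) _; rewrite lerD //.
  by rewrite normrM (gtr0_norm c0) ler_wpM2r // ltW.
have uJ : (J.1 <= #|induced_edges G U| <= J.2)%N.
  move: uk; rewrite ler_norml => /andP[uk1 uk2].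
  have k1 : (k <= #|induced_edges G U| + t)%N.
    by rewrite -(ler_nat R) natrD; lra.
  have k2 : (#|induced_edges G U| <= k + t)%N.
    by rewrite -(ler_nat R) natrD; lra.
  by apply/andP; split; lia.
apply: (@arrows_induced _ G U); rewrite cU.
have uc := card_induced_edges_leq G U; rewrite cU -ltnS in uc.
have : Ordinal uc \in Sset n m f.
  apply: (fintype.subsetP sS); rewrite /int_intervals mem_bigcup_seq.
  by apply/hasP; exists J; rewrite // inE.
by rewrite inE => /asboolP.
Qed.

(** Each deep [k] yields a block of [w] consecutive edge counts [k * w + j] with [j < w]; blocks of
    distinct [k] are disjoint by uniqueness of quotient and remainder. *)
Lemma card_Sset_ge (R : realType) (m f n N t : nat) (s : seq (nat * nat)) :
  (2 <= n <= N)%N -> ('C(n, 2) ^ 2 <= 'C(N, 2))%N ->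
  int_intervals ('C(n, 2)).+1 s \subset Sset n m f ->
  4 / Num.sqrt n%:R * 'C(n, 2)%:R + 1 <= t%:R :> R ->
  (#|deep_set 'C(n, 2) t s| * ('C(N, 2) %/ 'C(n, 2)) <= #|Sset N m f|)%N.
Proof.
move=> nN cM sS tb.
have c0 : (0 < 'C(n, 2))%N by rewrite bin_gt0; case/andP: nN.
have M0 : (0 < 'C(N, 2))%N by rewrite bin_gt0; case/andP: nN => /leq_trans h /h.
set c := 'C(n, 2) in c0 cM tb *; set M := 'C(N, 2) in M0 cM *.
set w := (M %/ c)%N.
pose h (p : 'I_c * 'I_w) : 'I_M.+1 := inord (p.1 * w + p.2).
have wcM : (w * c <= M)%N by rewrite leq_divM.
have hE p : h p = (p.1 * w + p.2)%N :> nat.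
  rewrite inordK // ltnS; apply: leq_trans wcM.
  case: p => k j /=; have := ltn_ord k; have := ltn_ord j; nia.
have h_inj : injective h.
  move=> [k j] [k' j'] /(congr1 (@nat_of_ord _)); rewrite !hE /= => eq.
  have w0 : (0 < w)%N by apply: leq_ltn_trans (ltn_ord j).
  congr (_, _); apply: val_inj => /=.
    by have := congr1 (divn^~ w) eq; rewrite /= !divnMDl // !divn_small // !addn0.
  by have := congr1 (modn^~ w) eq; rewrite /= !modnMDl !modn_small.
rewrite -[w in leqLHS]card_ord -cardsT -cardsX -(card_imset _ h_inj).
apply: subset_leq_card; apply/fintype.subsetP => _ /imsetP[[k j] + ->].
case/finset.setXP; rewrite inE => /hasP[J Js kJ] _.
rewrite inE; apply/asboolP.
apply: (arrows_deep_in nN sS Js kJ _ tb).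
rewrite -/c -/M hE /=.
have MR : 0 < M%:R :> R by rewrite ltr0n.
(* These two bounds say that the rescaled edge count is within 1 of [k]. The second replaces [w * c]
   by [M] at a cost of at most [k * c], which is below [c ^ 2 <= M]. *)
have e1 : ((k * w + j) * c <= k * M + M)%N.
  have := ltn_ord j; nia.
have e2 : (k * M <= (k * w + j) * c + M)%N.
  have := ltn_ord k; have := ltn_ceil M c0; rewrite -/w; nia.
rewrite ler_norml lerBrDr lerBlDr ler_pdivrMr // ler_pdivlMr //.
move: e1 e2; rewrite -!(ler_nat R) !natrD !natrM !natrD !natrM.
by move=> *; rewrite !mulrDl; apply/andP; split; lra.
Qed.

(** * Asymptotics of the densities *)

Lemma density_ge0 (R : realType) (m f n : nat) : 0 <= density R m f n.
Proof. by rewrite divr_ge0 ?ler0n. Qed.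

(** The bound is not 1, because there are ['C(n, 2) + 1] possible edge counts. *)
Lemma density_le2 (R : realType) (m f n : nat) : density R m f n <= 2.
Proof.
have : (#|Sset n m f| <= ('C(n, 2)).+1)%N by rewrite -[leqRHS]card_ord max_card.
rewrite /density; move: #|Sset n m f| => k; move: 'C(n, 2) => [|c] kc.
  by rewrite invr0 mulr0 ler0n.
by rewrite ler_pdivrMr ?ltr0n // -natrM ler_nat; lia.
Qed.

Lemma bin2_ge (N : nat) : (N.-1 <= 'C(N, 2))%N.
Proof. by case: N => //= N; rewrite binS bin1 leq_addl. Qed.

Lemma mul_leq_divn (g c M k : nat) :
  (0 < c)%N -> (g <= c)%N -> (g * (M %/ c) <= k)%N ->
  (g * M <= k * c + c * c)%N.
Proof. by move=> /(ltn_ceil M); move: (M %/ c)%N => w; nia. Qed.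

(* Each of the at most eps * sqrt n intervals loses O(n^(3/2)) elements near
   its ends, hence the total loss is O(eps) * 'C(n, 2). *)
Lemma density_ge_of_intervals (R : realType) (m f n : nat) (x eps : R)
    (s : seq (nat * nat)) :
  0 < eps -> (2 <= n)%N -> (size s)%:R <= eps * Num.sqrt n%:R ->
  int_intervals ('C(n, 2)).+1 s \subset Sset n m f ->
  (x - eps) * 'C(n, 2)%:R
    <= #|Sset n m f :&: int_intervals ('C(n, 2)).+1 s|%:R ->
  \forall N \near \oo%classic, x - 20 * eps <= density R m f N.
Proof.
move=> eps0 n2 ss sS xS.
have c0 : (0 < 'C(n, 2))%N by rewrite bin_gt0.
set r : R := Num.sqrt n%:R in ss *.
set c := 'C(n, 2) in c0 sS xS *.
have r1 : 1 <= r by rewrite -[leLHS]sqrtr1 ler_wsqrtr // ler1n ltnW.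
have rr : r * r = n%:R by rewrite -expr2 sqr_sqrtr // ler0n.
have c1 : 1 <= c%:R :> R by rewrite ler1n.
have rc : r <= 2 * c%:R.
  have nc : n%:R <= 2 * c%:R :> R.
    by rewrite -natrM ler_nat; have := bin2_ge n; rewrite -/c; lia.
  by apply: le_trans nc; rewrite -rr ler_peMl //; lra.
pose t := (Num.truncn (4 / r * c%:R)).+2.
have t0 : 0 <= 4 / r * c%:R by rewrite mulr_ge0 ?divr_ge0 //; lra.
have /andP[tl tu] := truncn_itv t0.
have tb1 : 4 / r * c%:R + 1 <= t%:R :> R by rewrite /t -[leRHS]natr1 lerD2r ltW.
have tb2 : t%:R <= 4 / r * c%:R + 2 by rewrite /t -addn2 natrD lerD2r.
set g := #|deep_set c t s|.
(* The 19 is 1 from the hypothesis, 8 from the main term of [t], where [r] cancels, and 10 from the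
   remaining [5 * (eps * r)] with [r <= 2 * c%:R]. *)
have gb : (x - 19 * eps) * c%:R <= g%:R.
  have := card_int_intervals_leq c t s; rewrite -/g -(ler_nat R).
  rewrite natrD natrM natrD natrM => h1.
  have h2 : (2 * t%:R + 1) * (size s)%:R
      <= (2 * (4 / r * c%:R + 2) + 1) * (eps * r).
    by rewrite ler_pM ?addr_ge0 ?mulr_ge0 ?ler0n //; lra.
  have h3 : (2 * (4 / r * c%:R + 2) + 1) * (eps * r)
      = 8 * (eps * c%:R) + 5 * (eps * r).
    by field; rewrite gt_eqF //; lra.
  have h4 : eps * r <= eps * (2 * c%:R) by rewrite ler_wpM2l // ltW.
  have h5 : #|Sset n m f :&: int_intervals c.+1 s|%:R
      <= #|int_intervals c.+1 s|%:R :> R.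
    by rewrite ler_nat subset_leq_card // finset.subsetIr.
  lra.
have gc : (g <= c)%N by rewrite -[leqRHS]card_ord max_card.
near=> N.
have nN : (2 <= n <= N)%N by rewrite n2; near: N; exact: nbhs_infty_ge.
have cN : (c ^ 2 <= 'C(N, 2))%N.
  have cN' : ((c ^ 2).+1 <= N)%N by near: N; exact: nbhs_infty_ge.
  by apply: leq_trans (bin2_ge N); rewrite -ltnS (ltn_predK cN').
(* For such [N] the loss from rounding ['C(N, 2) %/ c] down is at most one further [eps], which
   gives the 20. *)
have eN : c%:R / eps <= 'C(N, 2)%:R.
  have : (c%:R / eps + 1 <= N%:R) by near: N; exact: nbhs_infty_ger.
  have := bin2_ge N; rewrite -(ler_nat R).
  have -> : (N.-1)%:R = N%:R - 1 :> R.
    have N0 : (0 < N)%N by case/andP: nN => /ltnW /leq_trans h /h.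
    by rewrite -[in RHS](prednK N0) -natr1 addrK.
  lra.
set M := 'C(N, 2) in cN eN *.
have M0 : (0 < M)%N by apply: leq_trans cN; rewrite expn_gt0 c0.
have SN := card_Sset_ge nN cN sS tb1; rewrite -/g -/c -/M in SN.
have MR : 0 < M%:R :> R by rewrite ltr0n.
have SNc : (g * M <= #|Sset N m f| * c + c * c)%N by exact: mul_leq_divn.
rewrite /density -/M ler_pdivlMr //.
have cR : 0 < c%:R :> R by lra.
rewrite -(ler_pM2r cR).
move: SNc; rewrite -(ler_nat R) natrD !natrM.
rewrite ler_pdivrMr // in eN.
have h6 : (x - 19 * eps) * c%:R * M%:R <= g%:R * M%:R by rewrite ler_wpM2r ?ler0n.
have h7 : c%:R * c%:R <= M%:R * eps * c%:R by rewrite ler_wpM2r ?ler0n.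
lra.
Unshelve. all: by end_near.
Qed.

(* The intervals are required to consist of elements of Sset n m f: without this
   the single interval from 0 to 'C(n, 2) would make the hypothesis void.
   The bound 2 <= n excludes the case 'C(n, 2) = 0, void as well. *)
Theorem lemma5p1 (R : realType) (m f : nat)
    (hm : (2 <= m)%N) (hf : (f <= 'C(m, 2))%N)
    (hsigma : 0 < sigma R m f)
    (hint : forall eps : R, 0 < eps ->
      exists (n : nat) (s : seq (nat * nat)),
        [/\ (2 <= n)%N,
            (size s)%:R <= eps * Num.sqrt n%:R,
            int_intervals ('C(n, 2)).+1 s \subset Sset n m f &
            (sigma R m f - eps) * 'C(n, 2)%:R
              <= #|Sset n m f :&: int_intervals ('C(n, 2)).+1 s|%:R]) :
  cvgn (density R m f).
Proof.
have ub : has_ubound (range (density R m f)).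
  by exists 2 => _ [n _ <-]; exact: density_le2.
have lb : has_lbound (range (density R m f)).
  by exists 0 => _ [n _ <-]; exact: density_ge0.
(* The tail suprema give the upper bound on the densities. The lower bound comes from a single [n],
   which serves all large [N]. *)
have cs : (sups (density R m f) @ \oo --> sigma R m f)%classic.
  have h := cvg_sups_inf ub lb.
  by rewrite /sigma /limn_sup (cvg_lim _ h).
apply/cvg_ex; exists (sigma R m f); apply/cvgrPdist_le => eps eps0.
have e20 : 0 < eps / 20 by rewrite divr_gt0.
have [n [s [n2 ss sS xS]]] := hint _ e20.
have lo := density_ge_of_intervals e20 n2 ss sS xS.
move/cvgrPdist_le: cs => /(_ _ eps0) up.
near=> N.
have loN : sigma R m f - 20 * (eps / 20) <= density R m f N by near: N.
have upN : `|sigma R m f - sups (density R m f) N| <= eps by near: N.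
have le_sups : density R m f N <= sups (density R m f) N.
  by apply: ub_le_sup; [exact: has_ubound_sdrop|exists N => /=].
move: upN; rewrite !ler_norml => /andP[u1 u2].
rewrite mulrC divfK ?pnatr_eq0 // in loN.
by apply/andP; split; lra.
Unshelve. all: by end_near.
Qed.
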